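(* Let $t_0<t_1$ be real numbers, $L,d\in\mathbb{N}$, $\varepsilon=(t_1-t_0)2^{-L}$, and let $(w_r)_{r\in[t_0,t_1]}$ be the path generated by the Virtual Brownian Tree on $[t_0,t_1]$ with tolerance $\varepsilon$ in dimension $d$, using the Brownian-bridge final interpolation, with a uniformly random seed that is fixed throughout (construction and idealised randomness model as given in the context). Let $V=\{t_0+(t_1-t_0)k2^{-L}:k\in\{0,1,\dots,2^L\}\}$ and let $S=\{r_1,\dots,r_N\}\subset[t_0,t_1]$ be a set of query times such that for all $1\le n<N$ we have $r_n\le r_{n+1}$ and $|V\cap[r_n,r_{n+1}]|\ge1$. If $W=(W_r)_{r\in[t_0,t_1]}$ is a standard $d$-dimensional Brownian motion started from $W_{t_0}=0$, then $$(w_{r_1},\dots,w_{r_N})\overset{d}{=}(W_{r_1},\dots,W_{r_N}).$$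
   Context: **Randomness model.** The pseudo-random generator is idealised: with a uniformly random seed, the Gaussian vectors attached below to the root, to the internal nodes and to the leaves of the binary tree are exactly $N(0,I_d)$ and mutually independent, and each is the same in every evaluation (it depends only on the seed and the node, not on the query time). **Virtual Brownian Tree (Brownian increments only).** *Root:* $w_{t_0}=0$ and $w_{t_1}=\sqrt{t_1-t_0}\,G_{\mathrm{root}}$ with $G_{\mathrm{root}}\sim N(0,I_d)$. *Midpoint step:* for each $0\le l<L$ and each dyadic interval $[s,u]$ with $s=t_0+(t_1-t_0)k2^{-l}$, $u=t_0+(t_1-t_0)(k+1)2^{-l}$, $0\le k<2^l$, put $t=\frac{s+u}2$ and $$w_t=\frac{w_s+w_u}{2}+\tfrac12\sqrt{u-s}\;G_{[s,u]},\qquad G_{[s,u]}\sim N(0,I_d)\ \text{attached to the node }[s,u].$$ This defines $w_v$ for all $v\in V$. *Final interpolation:* for $r\in[t_0,t_1]$ let $[s,u]$ be the leaf interval, whose endpoints are consecutive points of $V$, with $s<r\le u$ (the first leaf if $r=t_0$), and set $$w_r=w_s+\frac{r-s}{u-s}(w_u-w_s)+\sqrt{\frac{(r-s)(u-r)}{u-s}}\;\zeta_{[s,u]},\qquad \zeta_{[s,u]}\sim N(0,I_d)\ \text{attached to the leaf }[s,u].$$ *)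

(* Defs.v *)
From mathcomp Require Import all_boot all_order all_algebra.
From mathcomp Require Import all_classical all_reals all_analysis.

Set Implicit Arguments.
Unset Strict Implicit.
Unset Printing Implicit Defensive.

Import Order.TTheory GRing.Theory Num.Theory.
Import numFieldNormedType.Exports.

Local Open Scope classical_set_scope.
Local Open Scope ring_scope.

Section probability.
Context {R : realType} {d0 : measure_display} {Omega : measurableType d0}.
Variable P : probability Omega R.

(* The family [X] restricted to the index set [D] is mutually independent:
   every finite subfamily, enumerated without repetition by [s], satisfies the
   product rule. *)
Definition mutually_independent (I : Type) (D : set I)
    {d1 : measure_display} {T : measurableType d1} (X : I -> Omega -> T) :=
  forall (n : nat) (s : 'I_n -> I), injective s -> (forall i, D (s i)) ->
  forall B : 'I_n -> set T, (forall i, measurable (B i)) ->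
  P (\bigcap_(i in [set: 'I_n]) (X (s i) @^-1` B i)) =
  (\prod_(i < n) P (X (s i) @^-1` B i))%E.

(* [X] is a random vector with law N(0, sigma^2 I_d), for [sigma > 0]; the
   second argument of [normal_prob] is the standard deviation. *)
Definition isotropic_gaussian (d : nat) (sigma : R) (X : Omega -> d.-tuple R) :=
  [/\ measurable_fun [set: Omega] X,
      forall (i : 'I_d) (B : set R), measurable B ->
        P ((fun om => tnth (X om) i) @^-1` B) = normal_prob 0 sigma B
    & mutually_independent [set: 'I_d]
        (fun i om => tnth (X om) i)].

Definition increment (d : nat) (W : R -> Omega -> d.-tuple R) (s t : R)
    (om : Omega) : d.-tuple R :=
  [tuple tnth (W t om) i - tnth (W s om) i | i < d].

(* Only the values of [W] at times in [t0, t1] are constrained. *)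
Record brownian_motion (t0 t1 : R) (d : nat) (W : R -> Omega -> d.-tuple R) :
    Prop := BrownianMotion {
  bm_measurable : forall t, t0 <= t <= t1 -> measurable_fun [set: Omega] (W t) ;
  bm_start : {ae P, forall om, W t0 om = [tuple 0 | _ < d]} ;
  bm_gaussian : forall s t, t0 <= s -> s < t -> t <= t1 ->
    isotropic_gaussian (Num.sqrt (t - s)) (increment W s t) ;
  bm_independent : forall (n : nat) (t : nat -> R),
    (forall i, (i <= n)%N -> t0 <= t i <= t1) ->
    (forall i, (i < n)%N -> t i <= t i.+1) ->
    mutually_independent [set: 'I_n] (fun i => increment W (t i) (t i.+1)) ;
  bm_continuous : {ae P, forall om, forall i : 'I_d,
    {within `[t0, t1], continuous (fun t => tnth (W t om) i)}} }.

End probability.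

Definition eq_in_law {R : realType}
    {d1 : measure_display} {Omega1 : measurableType d1}
    {d2 : measure_display} {Omega2 : measurableType d2}
    {d3 : measure_display} {T : measurableType d3}
    (P1 : probability Omega1 R) (X1 : Omega1 -> T)
    (P2 : probability Omega2 R) (X2 : Omega2 -> T) :=
  [/\ measurable_fun [set: Omega1] X1, measurable_fun [set: Omega2] X2
    & forall A : set T, measurable A ->
        pushforward P1 X1 A = pushforward P2 X2 A].

(* [Inner l k] is the node of the [k]-th dyadic interval of level [l], and
   [Leaf k] that of the [k]-th interval of the finest level. *)
Inductive vbt_node := Root | Inner of nat & nat | Leaf of nat.

Definition vbt_nodes (L : nat) : set vbt_node :=
  [set n | match n with
           | Root => True
           | Inner l k => (l < L)%N /\ (k < 2 ^ l)%N
           | Leaf k => (k < 2 ^ L)%N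
           end].

Definition vbt_noise {R : realType} {d0 : measure_display}
    {Omega : measurableType d0} (P : probability Omega R) (L d : nat)
    (Z : vbt_node -> Omega -> d.-tuple R) :=
  (forall n, vbt_nodes L n -> isotropic_gaussian P 1 (Z n)) /\
  mutually_independent P (vbt_nodes L) Z.

Section virtual_brownian_tree.
Context {R : realType}.
Variables (t0 t1 : R) (L : nat).

Definition dyadic (l k : nat) : R := t0 + (t1 - t0) * k%:R * 2 ^- l.

Definition dyadic_grid : set R := [set dyadic L k | k in [set k | (k <= 2 ^ L)%N]].

(* Value at the time [dyadic l k] of one coordinate of the path, [g n] being
   the same coordinate of the Gaussian vector of node [n]. For odd [k],
   [dyadic l.+1 k] is the midpoint of the interval number [k./2] of level [l];
   for even [k] it is the point number [k./2] of level [l]. *)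
Fixpoint vbt_grid (g : vbt_node -> R) (l k : nat) : R :=
  match l with
  | 0 => if k == 0 then 0 else Num.sqrt (t1 - t0) * g Root
  | l'.+1 =>
      if odd k then
        let s := dyadic l' k./2 in let u := dyadic l' k./2.+1 in
        (vbt_grid g l' k./2 + vbt_grid g l' k./2.+1) / 2
        + 2^-1 * Num.sqrt (u - s) * g (Inner l' k./2)
      else vbt_grid g l' k./2
  end.

(* The [k] with [dyadic L k < r <= dyadic L k.+1] if [t0 < r <= t1], and [0]
   if [r = t0]. *)
Definition vbt_leaf (r : R) : nat :=
  `|Num.ceil ((r - t0) / (t1 - t0) * 2 ^+ L)|%N.-1.

Definition vbt_coord (g : vbt_node -> R) (r : R) : R :=
  let k := vbt_leaf r in
  let s := dyadic L k in let u := dyadic L k.+1 in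
  let ws := vbt_grid g L k in let wu := vbt_grid g L k.+1 in
  ws + (r - s) / (u - s) * (wu - ws)
  + Num.sqrt ((r - s) * (u - r) / (u - s)) * g (Leaf k).

Definition vbt_path (Omega : Type) (d : nat)
    (Z : vbt_node -> Omega -> d.-tuple R) (r : R) (om : Omega) : d.-tuple R :=
  [tuple vbt_coord (fun n => tnth (Z n om) i) r | i < d].

End virtual_brownian_tree.

(* Main.v *)
(* Every step of the tree samples a Brownian bridge: over an interval of length h, a point
   at distance t from the left end splits the increment D ~ N(0, h), by means of an
   independent noise Z ~ N(0, 1), into t/h D + sqrt(t(h-t)/h) Z and the rest of D. Up to
   scaling this is a reflection of the standard Gaussian plane, so the two parts are
   independent with laws N(0, t) and N(0, h - t). Going down the levels, the increments over
   the grid, together with the noise not used so far, stay independent. The separation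
   hypothesis puts at most one query strictly inside each leaf, so the final interpolation
   is one more level of the same tree, with the query as splitting point. The increments
   along the refined grid thus have the same joint law as those of W, and both paths are
   the same partial sums of increments. *)
From HB Require Import structures.
Require Import Defs.
From mathcomp Require Import all_boot all_order all_algebra.
From mathcomp Require Import all_classical all_reals all_analysis.
From mathcomp Require Import measurable_realfun ring lra.
Import Order.TTheory GRing.Theory Num.Theory.
Import numFieldNormedType.Exports.
Local Open Scope classical_set_scope.
Local Open Scope ring_scope.

(** * Rotation invariance of the Gaussian plane *)

Section pushforward.
Local Open Scope ereal_scope.
Context {d1 d2 : measure_display} {T1 : measurableType d1}
  {T2 : measurableType d2} {R : realType}.

(** The image measure is delivered as a bundled measure known through one equation, the form in
    which the uniqueness theorems for measures are applied below. *)
Lemma pushforward_measure (m : {measure set T1 -> \bar R}) (f : T1 -> T2) :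
  measurable_fun setT f ->
  exists m' : {measure set T2 -> \bar R}, forall A, m' A = m (f @^-1` A).
Proof.
move=> mf.
by exists (measure_function_pushforward__canonical__measure_function_Measure m mf).
Qed.

Lemma density_measure (m : {measure set T1 -> \bar R}) (f : T1 -> \bar R) :
  measurable_fun setT f -> (forall x, 0 <= f x) ->
  exists m' : {measure set T1 -> \bar R}, forall A, m' A = \int[m]_(x in A) f x.
Proof.
move=> mf f0.
pose g A := \int[m]_(x in A) f x.
have g0 : g set0 = 0 by exact: integral_set0.
have gge0 A : 0 <= g A by exact: integral_ge0.
have gs : semi_sigma_additive g.
  move=> F mF tF mUF; rewrite /g ge0_integral_bigcup//=.
  - by apply: is_cvg_ereal_nneg_natsum_cond => n _ _; exact: integral_ge0.
  - exact: measurable_funTS.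
pose gm := isMeasure.Build _ _ _ g g0 gge0 gs.
pose m' : {measure set T1 -> \bar R} := HB.pack g gm.
by exists m'.
Qed.

End pushforward.

(* [lebesgue_measure] lives on [measurableTypeR R], whose display differs from
   the one of the canonical measurable structure of [R]. *)
Section real_lebesgue.
Context {R : realType}.

Let id' (x : measurableTypeR R) : R := x.

Let mid' : measurable_fun setT id'.
Proof. by move=> _ A mA; rewrite setTI. Qed.

Definition lebesgueR : set R -> \bar R := pushforward (@lebesgue_measure R) id'.

HB.instance Definition _ := isMeasure.Build _ _ _ lebesgueR
  (measure0 (@lebesgue_measure R)) (fun A => measure_ge0 (@lebesgue_measure R) A)
  (@measure_semi_sigma_additive _ _ _ (@lebesgue_measure R)).

Let lebesgueR_sigma_finite : sigma_finite setT lebesgueR.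
Proof. exact: (@sigma_finiteT _ _ _ (@lebesgue_measure R)). Qed.

HB.instance Definition _ := Measure_isSigmaFinite.Build _ _ _ lebesgueR
  lebesgueR_sigma_finite.

(** The image of Lebesgue measure under the affine map, multiplied by [a], gives each half-open
    interval its length, and this property characterises Lebesgue measure. *)
Lemma lebesgueR_affine (a b : R) (A : set R) : 0 < a -> measurable A ->
  lebesgueR ((fun x => a * x + b) @^-1` A) = (a^-1%:E * lebesgueR A)%E.
Proof.
move=> a0 mA.
have mf : measurable_fun [set: R] (fun x : R => a * x + b : R).
  by apply: measurable_funD => //; exact: measurable_funM.
have [m m'E] : exists m : {measure set (measurableTypeR R) -> \bar R},
    forall B, m B = lebesgue_measure ((fun x => a * x + b) @^-1` B) :=
  @pushforward_measure _ _ (measurableTypeR R) (measurableTypeR R) R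
    lebesgue_measure _ mf.
pose a' : {nonneg R} := NngNum (ltW a0).
suff -> : lebesgueR A = mscale a' m A.
  rewrite [X in (_ * X)%E](_ : _ = (a%:E * m A)%E)//.
  by rewrite m'E muleA -EFinM mulVf ?gt_eqF// mul1e.
apply: lebesgue_measure_unique => // _ [[c e] _ <-].
have a0' : a != 0 by rewrite gt_eqF.
rewrite [RHS](_ : _ = (a%:E * m `]c, e]%classic)%E)// m'E.
rewrite (_ : _ @^-1` _ = `](c - b) / a, (e - b) / a]%classic).
  rewrite !lebesgue_measure_itv/= !lte_fin ltr_pM2r ?invr_gt0// ltrD2r.
  case: ifP => _; last by rewrite mule0.
  by rewrite -!EFinB -EFinM; congr EFin; field.
apply/seteqP; split => x; rewrite /= !in_itv/= ltr_pdivrMr// ler_pdivlMr//;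
  by rewrite ltrBlDr lerBrDr mulrC.
Qed.

Lemma integral_lebesgueR (f : R -> \bar R) (A : set R) : measurable A ->
  measurable_fun A f -> (forall x, 0 <= f x)%E ->
  (\int[lebesgueR]_(x in A) f x = \int[lebesgue_measure]_(x in A) f x)%E.
Proof. by move=> mA mf f0; exact: ge0_integral_pushforward. Qed.

End real_lebesgue.

Section rotation.
Context {R : realType}.
Local Notation mu := (@lebesgueR R).
Local Notation mu2 := (mu \x mu)%E.

Lemma lebesgueR2_unique (m : {measure set (R * R) -> \bar R}) :
  (forall A B, measurable A -> measurable B -> m (A `*` B) = (mu A * mu B)%E) ->
  forall T, measurable T -> mu2 T = m T.
Proof. exact: product_measure_unique. Qed.

Let preserving (f : R * R -> R * R) := measurable_fun setT f /\
  forall T, measurable T -> mu2 (f @^-1` T) = mu2 T.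

Let preserving_comp f g : preserving f -> preserving g -> preserving (g \o f).
Proof.
move=> [mf fE] [mg gE]; split; first exact: measurableT_comp.
move=> T mT; rewrite comp_preimage fE ?gE//.
by rewrite -[X in measurable X]setTI; exact: mg.
Qed.

Let preservingP (f : R * R -> R * R) : measurable_fun setT f ->
  (forall A B, measurable A -> measurable B ->
    mu2 (f @^-1` (A `*` B)) = (mu A * mu B)%E) ->
  preserving f.
Proof.
move=> mf H; split=> // T mT; have [m mE] := pushforward_measure mu2 _ mf.
by rewrite -mE; apply/esym/lebesgueR2_unique => // A B mA mB; rewrite mE; exact: H.
Qed.

Let swap (z : R * R) := (z.2, z.1).
Let shear (a : R) (z : R * R) := (z.1, z.2 + a * z.1).

Let preserving_swap : preserving swap.
Proof.
apply: preservingP; first exact: measurable_fun_pair.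
move=> A B mA mB.
rewrite (_ : _ @^-1` _ = B `*` A); last by apply/seteqP; split => z [].
by rewrite product_measure1E// muleC.
Qed.

(** On each vertical line the shear is a translation, so every section keeps its length; integrating
    over the first coordinate gives the claim for rectangles. *)
Let preserving_shear (a : R) : preserving (shear a).
Proof.
apply: preservingP.
  by apply: measurable_fun_pair => //; apply: measurable_funD => //;
    exact: measurable_funM.
move=> A B mA mB; rewrite -product_measure1E//.
apply: eq_integral => x _ /=.
transitivity (mu ((fun y => 1 * y + a * x) @^-1` (xsection (A `*` B) x))).
  by congr (mu _); apply/seteqP; split => y; rewrite /xsection/= !inE/= mul1r.
by rewrite lebesgueR_affine ?invr1 ?mul1e//; apply: measurable_xsection;
  exact: measurableX.
Qed.

(** For [c ^+ 2 + s ^+ 2 = 1] this is an orthogonal map of determinant -1. It is preferred to a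
    rotation because a bridge step takes exactly this form after scaling. *)
Definition reflection (c s : R) (z : R * R) :=
  (c * z.1 + s * z.2, s * z.1 - c * z.2).

(* Up to a coordinate swap a reflection is a rotation, which is a product of three shears. *)
Lemma lebesgueR2_reflection (c s : R) : 0 <= s -> c ^+ 2 + s ^+ 2 = 1 ->
  measurable_fun setT (reflection c s) /\
  forall T, measurable T -> mu2 (reflection c s @^-1` T) = mu2 T.
Proof.
move=> s0 cs1; rewrite -/(preserving _).
(* The shear coefficient divides by [c]. When [c = 0], the sign condition on [s] forces [s = 1], and
   the reflection is the swap. *)
have [c0|c0] := eqVneq c 0.
  have s1 : s = 1.
    by apply/eqP; rewrite -(@eqrXn2 _ 2)// expr1n -cs1 c0 expr0n/= add0r.
  suff -> : reflection c s = swap by [].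
  by apply/funext => z; rewrite /reflection /swap c0 s1 !mul0r !mul1r add0r subr0.
(* For the rotation with cosine [s] and sine [c], this is the tangent of the half angle, the
   coefficient of the two outer shears. Everything rests on [a * c = 1 - s] and
   [a * (1 + s) = c]. *)
pose a := (1 - s) / c.
have pU : preserving (swap \o shear a \o swap).
  exact: (preserving_comp _ _ preserving_swap
    (preserving_comp _ _ (preserving_shear a) preserving_swap)).
suff -> : reflection c s =
    ((swap \o shear a \o swap) \o shear (- c) \o (swap \o shear a \o swap)) \o swap.
  exact: (preserving_comp _ _ preserving_swap (preserving_comp _ _ pU
    (preserving_comp _ _ (preserving_shear (- c)) pU))).
apply/funext => -[x y]; rewrite /reflection /swap /shear/=.
have ac : a * c = 1 - s by rewrite divfK.
have aE : a * (1 + s) = c.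
  by apply: (mulIf c0); rewrite mulrAC ac; nra.
(* The two identities are multiplied by the monomials that occur, which leaves a linear problem. *)
have acx := congr1 (fun t => t * x) ac; have acy := congr1 (fun t => t * y) ac.
have aEx := congr1 (fun t => t * x) aE.
have aacx := congr1 (fun t => t * (a * x)) ac.
by rewrite /= in acx acy aEx aacx; congr pair; lra.
Qed.

Let pdf (x : R) := normal_pdf 0 1 x.

(** The product density depends on [z] only through its squared norm, which the reflection
    preserves. *)
Lemma normal_pdf_reflection (c s : R) z : c ^+ 2 + s ^+ 2 = 1 ->
  pdf (reflection c s z).1 * pdf (reflection c s z).2 = pdf z.1 * pdf z.2.
Proof.
move=> cs1; rewrite /pdf !normal_pdfE ?oner_eq0// mulrACA [RHS]mulrACA.
congr (_ * _); rewrite /normal_fun -!expRD; congr expR.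
rewrite !subr0 -!mulrDl -!opprD; congr (- _ / _).
transitivity ((c ^+ 2 + s ^+ 2) * (z.1 ^+ 2 + z.2 ^+ 2)).
  by rewrite /reflection/=; ring.
by rewrite cs1 mul1r.
Qed.

End rotation.

Section standard_normal.
Context {R : realType}.

Let id' (x : measurableTypeR R) : R := x.

(** The standard normal law, moved to the canonical measurable structure of [R] in the same way as
    [lebesgueR]. *)
Definition normal1 : set R -> \bar R := pushforward (normal_prob (0 : R) 1) id'.

HB.instance Definition _ := isMeasure.Build _ _ _ normal1
  (measure0 (normal_prob (0 : R) 1)) (fun A => measure_ge0 (normal_prob (0 : R) 1) A)
  (@measure_semi_sigma_additive _ _ _ (normal_prob (0 : R) 1)).

HB.instance Definition _ := Measure_isProbability.Build _ _ _ normal1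
  (probability_setT (normal_prob (0 : R) 1)).

Let pdf (x : R) : R := normal_pdf 0 1 x.

Let mpdf : measurable_fun setT pdf.
Proof. exact: (measurable_normal_pdf 0 1). Qed.

Lemma normal1E A : measurable A -> normal1 A = (\int[lebesgueR]_(x in A) (pdf x)%:E)%E.
Proof.
move=> mA; rewrite integral_lebesgueR//.
  by apply/measurable_EFinP; exact: measurable_funTS.
by move=> x; rewrite lee_fin normal_pdf_ge0.
Qed.

(** By Tonelli, the measure with the product density agrees with the product measure on rectangles,
    and rectangles determine the latter. *)
Lemma normal1_prod T : measurable T -> (normal1 \x normal1)%E T =
  (\int[lebesgueR \x lebesgueR]_(z in T) (pdf z.1 * pdf z.2)%:E)%E.
Proof.
move=> mT.
have mp : measurable_fun [set: R * R] (fun z => (pdf z.1 * pdf z.2)%:E).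
  apply/measurable_EFinP; apply: measurable_funM; exact: measurableT_comp.
have p0 z : (0 <= (pdf z.1 * pdf z.2)%:E)%E.
  by rewrite lee_fin mulr_ge0// normal_pdf_ge0.
have [m mE] := density_measure (lebesgueR \x lebesgueR)%E _ mp p0.
rewrite -mE; apply: product_measure_unique => // A B mA mB.
rewrite mE integral_mkcond fubini_tonelli1; last 2 first.
- by apply/(measurable_restrictT _ (measurableX mA mB)); exact: measurable_funTS.
- by move=> z; rewrite patchE; case: ifP.
have mpE D : measurable_fun D (fun x => (pdf x)%:E).
  by apply/measurable_EFinP; exact: measurable_funTS.
have pE0 x : (0 <= (pdf x)%:E)%E by rewrite lee_fin normal_pdf_ge0.
have FE x : fubini_F lebesgueR ((fun z => (pdf z.1 * pdf z.2)%:E) \_ (A `*` B)) x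
    = (normal1 B * ((fun x => (pdf x)%:E) \_ A) x)%E.
  rewrite /fubini_F patchE; case: ifPn => xA; last first.
    rewrite mule0; apply: integral0_eq => y _; rewrite patchE ifF//.
    by apply/negbTE; apply: contra xA; rewrite !inE => -[].
  rewrite muleC normal1E// [in RHS]integral_mkcond -ge0_integralZl//.
  - apply: eq_integral => y _; rewrite !patchE in_setX/= xA/=.
    by case: ifP => _; rewrite ?mule0// EFinM.
  - exact/(measurable_restrictT _ mB).
  - by move=> y _; rewrite patchE; case: ifP.
under eq_integral do rewrite FE.
rewrite ge0_integralZl//.
- by rewrite -integral_mkcond -normal1E// muleC.
- exact/(measurable_restrictT _ mA).
- by move=> y _; rewrite patchE; case: ifP.
Qed.

(** Change of variables: the reflection preserves both the Lebesgue measure of the plane and the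
    Gaussian density. On rectangles this says that the reflected coordinates are again independent
    standard normals. *)
Lemma normal1_reflection (c s : R) A B : 0 <= s -> c ^+ 2 + s ^+ 2 = 1 ->
  measurable A -> measurable B ->
  (normal1 \x normal1)%E (reflection c s @^-1` (A `*` B)) = (normal1 A * normal1 B)%E.
Proof.
move=> s0 cs1 mA mB; have [mr rE] := lebesgueR2_reflection c s s0 cs1.
have mAB : measurable (A `*` B) by exact: measurableX.
have mrAB : measurable (reflection c s @^-1` (A `*` B)).
  by rewrite -[X in measurable X]setTI; exact: mr.
have mp : measurable_fun [set: R * R] (fun z => (pdf z.1 * pdf z.2)%:E).
  apply/measurable_EFinP; apply: measurable_funM; exact: measurableT_comp.
have p0 z : (0 <= (pdf z.1 * pdf z.2)%:E)%E.
  by rewrite lee_fin mulr_ge0// normal_pdf_ge0.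
have <- := product_measure1E normal1 normal1 mA mB.
rewrite (normal1_prod _ mAB) (normal1_prod _ mrAB).
have <- : (\int[pushforward (lebesgueR \x lebesgueR) (reflection c s)]_(z in A `*` B)
    (pdf z.1 * pdf z.2)%:E = \int[lebesgueR \x lebesgueR]_(z in A `*` B)
    (pdf z.1 * pdf z.2)%:E)%E.
  by apply: eq_measure_integral => /= T mT _; exact: rE.
rewrite (ge0_integral_pushforward mr _ mAB (measurable_funTS mp)); last by move=> z _.
congr integral; apply/funext => z.
exact: (congr1 EFin (esym (normal_pdf_reflection c s z cs1))).
Qed.

End standard_normal.

(** * Splitting an increment *)

Section gauss.
Context {R : realType}.

(* Unlike [normal_prob 0 0], [gauss 0] is the Dirac mass at [0]. *)
Definition gauss (s : R) (B : set R) : \bar R := normal1 ((fun x => s * x) @^-1` B).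

Lemma measurable_scale (s : R) : measurable_fun [set: R] (fun x => s * x).
Proof. exact: measurable_funM. Qed.

Lemma measurable_preimage {d1 d2} {T1 : measurableType d1} {T2 : measurableType d2}
  (f : T1 -> T2) (B : set T2) : measurable_fun setT f -> measurable B ->
  measurable (f @^-1` B).
Proof. by move=> mf mB; rewrite -[X in measurable X]setTI; exact: mf. Qed.

(** Substitution of [s * x]: the factor [s] between the two densities cancels the [s^-1] from the
    scaling of Lebesgue measure. *)
Lemma normal_prob_gauss (s : R) (B : set R) : 0 < s -> measurable B ->
  normal_prob 0 s B = gauss s B.
Proof.
move=> s0 mB; have ms := measurable_scale s.
have mpdf : measurable_fun setT (fun x => (normal_pdf 0 s x)%:E).
  by apply/measurable_EFinP; exact: (measurable_normal_pdf 0 s).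
have mD := measurable_preimage _ _ ms mB.
have pE x : (0 <= (normal_pdf 0 s x)%:E)%E by rewrite lee_fin normal_pdf_ge0.
rewrite /normal_prob -integral_lebesgueR//; last exact: measurable_funTS.
rewrite /gauss (normal1E _ mD).
have pdfE x : normal_pdf 0 1 x = s * normal_pdf 0 s (s * x).
  rewrite !normal_pdfE ?oner_eq0 ?gt_eqF// mulrA; congr (_ * _).
    rewrite /normal_peak expr1n mul1r -mulrnAr sqrtrM ?sqr_ge0// sqrtr_sqr.
    by rewrite gtr0_norm// invfM mulrA divff ?gt_eqF// mul1r.
  rewrite /normal_fun; congr expR; rewrite !subr0 exprMn.
  have s0' : s != 0 by rewrite gt_eqF.
  by rewrite expr1n -[s ^+ 2 *+ 2]mulr_natr; field.
transitivity (\int[lebesgueR]_(x in (fun x => s * x)%R @^-1` B)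
   (s%:E * (normal_pdf 0 s (s * x)%R)%:E))%E; last first.
  by apply: eq_integral => x _; rewrite pdfE EFinM.
have mpdfs : measurable_fun setT (fun x => (normal_pdf 0 s (s * x))%:E).
  exact: (measurableT_comp mpdf ms).
rewrite (ge0_integralZl lebesgueR mD (measurable_funTS mpdfs)); last 2 first.
- by move=> x _; exact: pE.
- by rewrite lee_fin ltW.
have <- := ge0_integral_pushforward ms lebesgueR mB (measurable_funTS mpdf)
  (fun x _ => pE x).
have si0 : 0 <= s^-1 by rewrite invr_ge0 ltW.
pose si : {nonneg R} := NngNum si0.
rewrite [in RHS](@eq_measure_integral _ _ _ B (mscale si lebesgueR)); last first.
  move=> /= T mT _; transitivity (lebesgueR ((fun x => s * x + 0) @^-1` T)).
    have -> // : (fun x : R => s * x + 0) = (fun x : R => s * x).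
    by apply: funext => x; rewrite addr0.
  by rewrite lebesgueR_affine.
rewrite ge0_integral_mscale//; last exact: measurable_funTS.
by rewrite muleA -EFinM/= divff ?mul1e// gt_eqF.
Qed.

Lemma gaussT (s : R) : gauss s setT = 1%E.
Proof. exact: probability_setT. Qed.

Lemma gauss1 : gauss (1 : R) = normal1.
Proof.
apply/funext => B; rewrite /gauss; congr (normal1 _).
by apply/seteqP; split => x; rewrite /= mul1r.
Qed.

Lemma gauss0 (B : set R) : gauss 0 B = (\1_B 0)%:E.
Proof.
rewrite /gauss indicE; have [B0|B0] := boolP (0 \in B).
  rewrite (_ : _ @^-1` B = setT) ?probability_setT//.
  by apply/seteqP; split => x //= _; rewrite mul0r; rewrite inE in B0.
rewrite (_ : _ @^-1` B = set0) ?measure0//.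
apply/seteqP; split => x //=; rewrite mul0r => /mem_set; exact/negP.
Qed.

(** With [a], [b], [e] the square roots of [t], [h - t], [h], the two parts are [a] and [b] times
    the coordinates of [reflection (a / e) (b / e)]. The degenerate cases [t = 0] and [t = h] are
    included. *)
Lemma bridge_split (h t : R) A B : 0 < h -> 0 <= t <= h ->
  measurable A -> measurable B ->
  (normal1 \x normal1)%E [set z |
    A (t / h * (Num.sqrt h * z.1) + Num.sqrt (t * (h - t) / h) * z.2) /\
    B (Num.sqrt h * z.1 -
       (t / h * (Num.sqrt h * z.1) + Num.sqrt (t * (h - t) / h) * z.2))] =
  (gauss (Num.sqrt t) A * gauss (Num.sqrt (h - t)) B)%E.
Proof.
move=> h0 /andP[t0 th] mA mB; have ht0 : 0 <= h - t by rewrite subr_ge0.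
set a := Num.sqrt t; set b := Num.sqrt (h - t); set e := Num.sqrt h.
have e0 : e != 0 by rewrite gt_eqF// sqrtr_gt0.
have aE : t = a ^+ 2 by rewrite sqr_sqrtr.
have bE : h - t = b ^+ 2 by rewrite sqr_sqrtr.
have eE : h = e ^+ 2 by rewrite sqr_sqrtr// ltW.
have abe : b ^+ 2 = e ^+ 2 - a ^+ 2 by rewrite -aE -bE -eE.
have sE : Num.sqrt (t * (h - t) / h) = a * (b / e).
  by rewrite sqrtrM ?mulr_ge0// sqrtrM// sqrtrV ?ltW// mulrA.
have mA' := measurable_preimage _ _ (measurable_scale a) mA.
have mB' := measurable_preimage _ _ (measurable_scale b) mB.
have be0 : 0 <= b / e by rewrite divr_ge0// sqrtr_ge0.
have cs1 : (a / e) ^+ 2 + (b / e) ^+ 2 = 1.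
  by rewrite !expr_div_n abe; field.
rewrite /gauss -(normal1_reflection _ _ _ _ be0 cs1 mA' mB').
congr ((_ \x _)%E _); apply/funext => -[x z]; rewrite /reflection/= sE.
rewrite /setX/=; congr (A _ /\ B _).
  by rewrite aE eE; field.
transitivity ((e ^+ 2 - a ^+ 2) / e * x - a * (b / e) * z).
  by rewrite aE eE; field.
by rewrite -abe; field.
Qed.

End gauss.

(** * Extending product rules from a pi-system *)

Section pi_system.
Context {R : realType} {d0 d : measure_display} {Omega : measurableType d0}
  {T : measurableType d}.
Variable P : probability Omega R.

Lemma measurable_bigsetI (I : Type) (s : seq I) (F : I -> set Omega) :
  (forall i, measurable (F i)) -> measurable (\big[setI/setT]_(i <- s) F i).
Proof.
by move=> mF; elim/big_ind: _ => //; exact: measurableI.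
Qed.

(** The sets are freed from [G] one coordinate at a time. With all other coordinates fixed, both
    sides are finite measures of the remaining set and agree on the pi-system [G]. The event [E]
    will carry the noise left for later levels. *)
Lemma pi_system_extension (G : set (set T)) (C : finType) (Y : C -> Omega -> T)
    (m : C -> probability T R) (E : set Omega) :
  measurable = <<s G >> -> setI_closed G -> G setT ->
  (forall c, measurable_fun setT (Y c)) -> measurable E ->
  (forall B : C -> set T, (forall c, G (B c)) ->
    P (\big[setI/setT]_(c : C) (Y c @^-1` B c) `&` E) =
    ((\prod_(c : C) m c (B c)) * P E)%E) ->
  forall B : C -> set T, (forall c, measurable (B c)) ->
    P (\big[setI/setT]_(c : C) (Y c @^-1` B c) `&` E) =
    ((\prod_(c : C) m c (B c)) * P E)%E.
Proof.
move=> mG GI GT mY mE H B mB.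
have subG X : G X -> measurable X by rewrite mG; exact: sub_sigma_algebra.
(* The list [s] holds the coordinates whose sets are already arbitrary; outside it the sets still
   lie in [G]. *)
suff K (s : seq C) : forall B : C -> set T, (forall c, measurable (B c)) ->
    (forall c, c \notin s -> G (B c)) ->
    P (\big[setI/setT]_(c : C) (Y c @^-1` B c) `&` E) =
    ((\prod_(c : C) m c (B c)) * P E)%E.
  by apply: (K (enum C)) => // c; rewrite mem_enum.
elim: s => [|c0 s IH] {mB}B mB sB; first by apply: H => c; exact: sB.
pose upd (U : set T) c := if c == c0 then U else B c.
pose F := \big[setI/setT]_(c | c != c0) (Y c @^-1` B c) `&` E.
pose k := (\prod_(c | c != c0) m c (B c) * P E)%E.
have mF : measurable F.
  apply: measurableI => //; rewrite big_mkcond; apply: measurable_bigsetI => c.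
  by case: ifP => // _; exact: measurable_preimage.
have bI U : \big[setI/setT]_(c : C) (Y c @^-1` upd U c) `&` E = Y c0 @^-1` U `&` F.
  rewrite (bigD1 c0)//= /upd eqxx -setIA; congr (_ `&` (_ `&` _)).
  by apply: eq_bigr => c /negbTE ->.
have bP U : ((\prod_(c : C) m c (upd U c)) * P E = m c0 U * k)%E.
  rewrite (bigD1 c0)//= /upd eqxx -muleA; congr (_ * (_ * _))%E.
  by apply: eq_bigr => c /negbTE ->.
have HU U : G U -> P (Y c0 @^-1` U `&` F) = (m c0 U * k)%E.
  move=> GU; rewrite -bI -bP; apply: IH => c; rewrite /upd.
    by case: ifP => // _; exact: subG.
  by case: eqVneq => // cc0 cs; apply: sB; rewrite inE negb_or cc0.
have k0 : (0 <= k)%E by rewrite mule_ge0// prode_ge0.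
have kfin : k \is a fin_num.
  by rewrite fin_numM// ?fin_num_measure// prode_fin_num// => c _; rewrite fin_num_measure.
pose k' : {nonneg R} := NngNum (fine_ge0 k0).
(* [m1] is the left side as a measure in the set of coordinate [c0]; it is compared with [m c0]
   scaled by the constant [k]. *)
have [m1 m1E] := pushforward_measure (mrestr P mF) (Y c0) (mY c0).
have -> : B = upd (B c0) by apply/funext => c; rewrite /upd; case: eqP => [->|].
rewrite bI bP.
have <- : m1 (B c0) = P (Y c0 @^-1` B c0 `&` F) by rewrite m1E.
have kE U : mscale k' (m c0) U = (m c0 U * k)%E.
  by rewrite muleC /mscale/= fineK.
rewrite -kE.
apply: (measure_unique G (fun=> setT)) => //.
- by rewrite bigcup_const.
- move=> U GU; rewrite m1E; transitivity (m c0 U * k)%E; first exact: HU.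
  exact/esym/kE.
- move=> _; rewrite m1E; apply: (@le_lt_trans _ _ 1%E); last exact: ltry.
  by apply: probability_le1; rewrite preimage_setT setTI.
Qed.

End pi_system.

(** * Splitting along a binary tree *)

Lemma pushforward_probability {d1 d2} {T1 : measurableType d1}
    {T2 : measurableType d2} {R : realType} (m : probability T1 R) (f : T1 -> T2) :
  measurable_fun setT f ->
  exists m' : probability T2 R, forall A, m' A = m (f @^-1` A).
Proof.
move=> mf; pose mixin := isMeasurableFun.Build _ _ _ _ _ mf.
pose f' : {mfun T1 >-> T2} := HB.pack f mixin.
by exists (distribution m f').
Qed.

Lemma big_ord_double (T : Type) (idx : T) (op : Monoid.law idx) (n : nat) (F : nat -> T) :
  \big[op/idx]_(j < n.*2) F j = \big[op/idx]_(k < n) op (F k.*2) (F k.*2.+1).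
Proof.
elim: n => [|n IH]; first by rewrite !big_ord0.
by rewrite doubleS !big_ord_recr/= IH Monoid.mulmA.
Qed.

Section bridge_step.
Context {R : realType} {d0 : measure_display} {Omega : measurableType d0}.
Variables (P : probability Omega R) (C : finType) (X Z : C -> Omega -> R).
Variables (h t : C -> R) (E : set Omega).
Hypothesis h_gt0 : forall c, 0 < h c.
Hypothesis t_itv : forall c, 0 <= t c <= h c.
Hypothesis mX : forall c, measurable_fun setT (X c).
Hypothesis mZ : forall c, measurable_fun setT (Z c).
Hypothesis mE : measurable E.
Hypothesis XZ : forall A B : C -> set R,
  (forall c, measurable (A c)) -> (forall c, measurable (B c)) ->
  P (\big[setI/setT]_c (X c @^-1` A c `&` Z c @^-1` B c) `&` E) =
  ((\prod_c (gauss (Num.sqrt (h c)) (A c) * normal1 (B c))) * P E)%E.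

Let inc c om := t c / h c * X c om + Num.sqrt (t c * (h c - t c) / h c) * Z c om.

(** All increments are split simultaneously. The events on the parts of increment [c] form a planar
    set for the pair of [X c] and [Z c]; the product rule passes from rectangles to such sets, and
    [bridge_split] computes their probability. *)
Lemma bridge_step (A B : C -> set R) :
  (forall c, measurable (A c)) -> (forall c, measurable (B c)) ->
  P (\big[setI/setT]_c ((fun om => inc c om) @^-1` A c `&`
       (fun om => X c om - inc c om) @^-1` B c) `&` E) =
  ((\prod_c (gauss (Num.sqrt (t c)) (A c) * gauss (Num.sqrt (h c - t c)) (B c)))
    * P E)%E.
Proof.
move=> mA mB.
(* The law [m c] of the pair is the image of the standard Gaussian plane under [sc c]. *)
pose sc c (z : R * R) := (Num.sqrt (h c) * z.1, z.2).
have msc c : measurable_fun [set: R * R] (sc c).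
  by apply: measurable_fun_pair => //; exact: measurable_funM.
have [m mE'] : {m : C -> probability (R * R)%type R |
    forall c T, m c T = (normal1 \x normal1)%E (sc c @^-1` T)}.
  have /choice[m H] : forall c, exists m : probability (R * R)%type R,
     forall T, m T = (normal1 \x normal1)%E (sc c @^-1` T).
    by move=> c; exact: pushforward_probability.
  by exists m.
pose f c (z : R * R) := t c / h c * z.1 + Num.sqrt (t c * (h c - t c) / h c) * z.2.
have mf c : measurable_fun [set: R * R] (f c).
  by apply: measurable_funD; exact: measurable_funM.
pose T c : set (R * R) := f c @^-1` A c `&` (fun z => z.1 - f c z) @^-1` B c.
have mT c : measurable (T c).
  apply: measurableI; apply: measurable_preimage => //.
  exact: measurable_funB.
pose Y c om := (X c om, Z c om).
have mY c : measurable_fun [set: Omega] (Y c) by exact: measurable_fun_pair.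
pose G : set (set (R * R)) := [set A' `*` B' | A' in measurable & B' in measurable].
have := @pi_system_extension R _ _ _ _ P G C Y m E _ _ _ mY mE _ T mT.
rewrite (_ : \prod_(c : C) m c (T c) =
  \prod_c (gauss (Num.sqrt (t c)) (A c) * gauss (Num.sqrt (h c - t c)) (B c)))%E; last first.
  by apply: eq_bigr => c _; rewrite mE' -bridge_split.
apply.
- exact: measurable_prod_measurableType.
- move=> _ _ [A1 mA1 [B1 mB1 <-]] [A2 mA2 [B2 mB2 <-]]; rewrite -setXI.
  by exists (A1 `&` A2); [exact: measurableI|exists (B1 `&` B2) => //; exact: measurableI].
- by exists setT => //; exists setT => //; rewrite setXTT.
move=> S GS.
have /choice[A' HA] : forall c, exists A', exists B',
    [/\ measurable A', measurable B' & S c = A' `*` B'].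
  by move=> c; have [A' mA' [B' mB' <-]] := GS c; exists A', B'.
have /choice[B' HB] := HA.
have mA' c : measurable (A' c) by case: (HB c).
have mB' c : measurable (B' c) by case: (HB c).
have SE c : S c = A' c `*` B' c by case: (HB c).
have := XZ A' B' mA' mB'.
rewrite (_ : \prod_c (gauss (Num.sqrt (h c)) (A' c) * normal1 (B' c)) =
  \prod_c m c (S c))%E; last first.
  apply: eq_bigr => c _; rewrite mE' SE.
  have mA'' := measurable_preimage _ _ (measurable_scale (Num.sqrt (h c))) (mA' c).
  by have <- := product_measure1E normal1 normal1 mA'' (mB' c).
move=> <-; congr (P (_ `&` _)); apply: eq_bigr => c _.
by rewrite SE.
Qed.

End bridge_step.

Section bridge_tree.
Context {R : realType} {d0 : measure_display} {Omega : measurableType d0}.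
Variables (P : probability Omega R) (n d : nat) (tau : nat -> nat -> R).
Variables (x g : nat -> nat -> 'I_d -> Omega -> R).

Definition level_event (F : nat -> 'I_d -> Omega -> R) (m : nat)
    (A : nat -> 'I_d -> set R) : set Omega :=
  \big[setI/setT]_(k < m) \big[setI/setT]_(i < d) (F k i @^-1` A k i).

(** The noise of level [m] produces the points of level [m.+1], so levels [l] and above are those
    not yet used by the increments of level [l]. *)
Definition noise_event l (B : nat -> nat -> 'I_d -> set R) : set Omega :=
  \big[setI/setT]_(l <= m < n) level_event (g m) (2 ^ m) (B m).

Definition noise_prob l (B : nat -> nat -> 'I_d -> set R) : \bar R :=
  (\prod_(l <= m < n) \prod_(k < 2 ^ m) \prod_(i < d) normal1 (B m k i))%E.

Let inc l k i om := x l k.+1 i om - x l k i om.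
Let len l k := tau l k.+1 - tau l k.

Hypothesis mx : forall l k i, (l < n)%N -> (k <= 2 ^ l)%N -> measurable_fun setT (x l k i).
Hypothesis mg : forall l k i, (l < n)%N -> (k < 2 ^ l)%N -> measurable_fun setT (g l k i).
Hypothesis tau_lt : forall l k, (l < n)%N -> (k < 2 ^ l)%N -> tau l k < tau l k.+1.
Hypothesis tau_double : forall l k, (l < n)%N -> tau l.+1 k.*2 = tau l k.
Hypothesis tau_mid : forall l k, (l < n)%N -> (k < 2 ^ l)%N ->
  tau l k <= tau l.+1 k.*2.+1 <= tau l k.+1.
Hypothesis x_double : forall l k, (l < n)%N -> x l.+1 k.*2 = x l k.
Hypothesis x_mid : forall l k i om, (l < n)%N -> (k < 2 ^ l)%N ->
  let s := tau l k in let u := tau l k.+1 in let t := tau l.+1 k.*2.+1 in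
  x l.+1 k.*2.+1 i om = x l k i om + (t - s) / (u - s) * (x l k.+1 i om - x l k i om)
    + Num.sqrt ((t - s) * (u - t) / (u - s)) * g l k i om.

Definition independent_at l := forall A B,
  (forall k i, measurable (A k i)) -> (forall m k i, measurable (B m k i)) ->
  P (level_event (inc l) (2 ^ l) A `&` noise_event l B) =
  ((\prod_(k < 2 ^ l) \prod_(i < d) gauss (Num.sqrt (len l k)) (A k i)) *
   noise_prob l B)%E.

(** An application of [bridge_step] indexed by pairs of an interval and a coordinate: the noise of
    level [l] splits the increments, and the later noise forms [E]. *)
Lemma independent_at_succ l : (l < n)%N -> independent_at l -> independent_at l.+1.
Proof.
move=> ln IH A B mA mB.
have xd k := x_double l k ln; have td k := tau_double l k ln.
pose C := ('I_(2 ^ l) * 'I_d)%type.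
pose X (c : C) := inc l c.1 c.2.
pose Z (c : C) := g l c.1 c.2.
pose h (c : C) := len l c.1.
pose t (c : C) := tau l.+1 c.1.*2.+1 - tau l c.1.
pose E := noise_event l.+1 B.
have htE (c : C) : h c - t c = tau l c.1.+1 - tau l.+1 c.1.*2.+1.
  by rewrite /h /t /len; ring.
have mE : measurable E.
  rewrite /E /noise_event big_seq; elim/big_ind: _ => //; first exact: measurableI.
  move=> m; rewrite mem_index_iota => /andP[_ mn].
  apply: measurable_bigsetI => k; apply: measurable_bigsetI => i.
  by apply: measurable_preimage => //; exact: mg.
have mX c : measurable_fun setT (X c).
  by apply: measurable_funB; apply: mx; rewrite // ltnW.
have mZ c : measurable_fun setT (Z c) by exact: mg.
have h0 c : 0 < h c by rewrite subr_gt0; exact: tau_lt.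
have t0 c : 0 <= t c <= h c.
  have /andP[t1 t2] := tau_mid l c.1 ln (ltn_ord _).
  by rewrite subr_ge0 t1 lerD2r.
have IH' (A' B' : C -> set R) : (forall c, measurable (A' c)) ->
    (forall c, measurable (B' c)) ->
    P (\big[setI/setT]_c (X c @^-1` A' c `&` Z c @^-1` B' c) `&` E) =
    ((\prod_c (gauss (Num.sqrt (h c)) (A' c) * normal1 (B' c))) *
     noise_prob l.+1 B)%E.
  move=> mA' mB'.
  (* Families over the finite type [C] are extended to all naturals by the full set. *)
  pose ext (S : C -> set R) k i :=
    if insub k is Some k' then S (k', i) else setT.
  have extE S (k : 'I_(2 ^ l)) i : ext S k i = S (k, i) by rewrite /ext valK.
  have mext S : (forall c, measurable (S c)) -> forall k i, measurable (ext S k i).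
    by move=> mS k i; rewrite /ext; case: insubP.
  pose B'' m := if m == l then ext B' else B m.
  have mB'' m k i : measurable (B'' m k i).
    by rewrite /B''; case: ifP => // _; exact: mext.
  have EB : noise_event l B'' = level_event (g l) (2 ^ l) (ext B') `&` E.
    rewrite /noise_event big_ltn// /B'' eqxx; congr (_ `&` _).
    by apply: eq_big_nat => m /andP[lm _]; rewrite gtn_eqF.
  have PB : noise_prob l B'' =
      ((\prod_(k < 2 ^ l) \prod_(i < d) normal1 (ext B' k i)) * noise_prob l.+1 B)%E.
    rewrite /noise_prob big_ltn// /B'' eqxx; congr (_ * _)%E.
    apply: eq_big_nat => m /andP[lm _]; apply: eq_bigr => k _; apply: eq_bigr => i _.
    by rewrite gtn_eqF.
  have levelE F S : level_event F (2 ^ l) (ext S) =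
      \big[setI/setT]_(c : C) F c.1 c.2 @^-1` S c.
    rewrite /level_event pair_bigA/=; apply: eq_bigr => -[k i] _.
    by rewrite extE.
  have := IH (ext A') B'' (mext _ mA') mB''.
  rewrite EB PB !levelE setIA -big_split/= => ->.
  rewrite muleA; congr (_ * _)%E; rewrite !pair_bigA/= -big_split/=.
  by apply: eq_bigr => -[k i] _; rewrite !extE.
(* Taking every set to be full isolates the probability of [E]. *)
have PE : P E = noise_prob l.+1 B.
  have := IH' (fun=> setT) (fun=> setT) (fun=> measurableT) (fun=> measurableT).
  rewrite big1; last by move=> c _; rewrite !preimage_setT setIT.
  rewrite big1; last by move=> c _; rewrite gaussT probability_setT mule1.
  by rewrite setTI mul1e.
rewrite -PE in IH'.
pose A1 (c : C) := A c.1.*2 c.2; pose A2 (c : C) := A c.1.*2.+1 c.2.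
have := bridge_step P C X Z h t E h0 t0 mX mZ mE IH' A1 A2
  (fun c => mA _ _) (fun c => mA _ _).
rewrite -/E -PE => H.
have -> : level_event (inc l.+1) (2 ^ l.+1) A =
    \big[setI/setT]_c ((fun om => t c / h c * X c om +
        Num.sqrt (t c * (h c - t c) / h c) * Z c om) @^-1` A1 c `&`
      (fun om => X c om - (t c / h c * X c om +
        Num.sqrt (t c * (h c - t c) / h c) * Z c om)) @^-1` A2 c).
  (* Interval [k] has the children [k.*2] and [k.*2.+1], so the product over the next level is
     grouped in pairs. *)
  rewrite /level_event expnS mul2n (big_ord_double _ _ _ _
    (fun k => \big[setI/setT]_(i < d) (inc l.+1 k i @^-1` A k i)))/=.
  under eq_bigr do rewrite -big_split/=.
  rewrite pair_bigA/=; apply: eq_bigr => c _.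
  have xm om := x_mid l c.1 c.2 om ln (ltn_ord _).
  have -> : inc l.+1 c.1.*2 c.2 = (fun om => t c / h c * X c om +
      Num.sqrt (t c * (h c - t c) / h c) * Z c om).
    apply/funext => om; rewrite /inc xm xd htE /X /t /h /len /inc.
    by rewrite addrAC [_ + _ / _ * _]addrC addrK.
  have -> // : inc l.+1 c.1.*2.+1 c.2 = (fun om => X c om - (t c / h c * X c om +
      Num.sqrt (t c * (h c - t c) / h c) * Z c om)).
  apply/funext => om; rewrite /inc -doubleS xd xm htE /X /t /h /len /inc.
  by rewrite -!addrA -!opprD addrA.
rewrite H; congr (_ * _)%E.
rewrite expnS mul2n (big_ord_double _ _ _ _
  (fun k => \prod_(i < d) gauss (Num.sqrt (len l.+1 k)) (A k i))%E)/=.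
under [RHS]eq_bigr do rewrite -big_split/=.
rewrite pair_bigA/=; apply: eq_bigr => c _.
by rewrite htE /t /len -doubleS !td.
Qed.

Lemma independent_at_last : independent_at 0 -> forall A,
  (forall k i, measurable (A k i)) ->
  P (level_event (inc n) (2 ^ n) A) =
  (\prod_(k < 2 ^ n) \prod_(i < d) gauss (Num.sqrt (len n k)) (A k i))%E.
Proof.
move=> H0; have H l : (l <= n)%N -> independent_at l.
  by elim: l => // l IH ln; apply: independent_at_succ => //; apply: IH; exact: ltnW.
move=> A mA; have := H n (leqnn n) A (fun _ _ _ => setT) mA (fun _ _ _ => measurableT).
by rewrite /noise_event /noise_prob !big_geq// setIT mule1.
Qed.

End bridge_tree.

(** * Laws of the increments *)

Definition box {R : realType} {d : nat} (S : 'I_d -> set R) : set (d.-tuple R) :=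
  [set v | forall i, S i (tnth v i)].

Lemma preimage_box {R : realType} {d : nat} {T : Type} (X : T -> d.-tuple R)
    (S : 'I_d -> set R) :
  X @^-1` box S = \big[setI/setT]_(i < d) ((fun om => tnth (X om) i) @^-1` S i).
Proof.
rewrite -bigcap_seq; apply/seteqP; split => om /= H i; first by move=> _; exact: H.
by apply: H => /=; rewrite mem_index_enum.
Qed.

Lemma measurable_box {R : realType} {d : nat} (S : 'I_d -> set R) :
  (forall i, measurable (S i)) -> measurable (box S).
Proof.
move=> mS; rewrite -[box S]/(id @^-1` box S) preimage_box.
apply: measurable_bigsetI => i; apply: measurable_preimage => //.
exact: measurable_tnth.
Qed.

Section product_rules.
Context {R : realType} {d0 : measure_display} {Omega : measurableType d0}.
Variable P : probability Omega R.

(** Independence in terms of a duplicate-free list of labels, which suits the mixed family made of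
    the root and the nodes of all levels. *)
Lemma mutually_independent_seq (I : Type) (D : set I) d1 (T : measurableType d1)
    (X : I -> Omega -> T) (K : choiceType) (s : seq K) (f : K -> I) (B : K -> set T) :
  mutually_independent P D X -> uniq s -> {in s &, injective f} ->
  (forall a, a \in s -> D (f a)) -> (forall a, measurable (B a)) ->
  P (\big[setI/setT]_(a <- s) (X (f a) @^-1` B a)) =
  (\prod_(a <- s) P (X (f a) @^-1` B a))%E.
Proof.
move=> indX us finj sD mB.
pose e (j : 'I_(size s)) := tnth (in_tuple s) j.
have es j : e j \in s by exact: mem_tnth.
have := indX _ (f \o e) _ (fun j => sD _ (es j)) (B \o e) (fun j => mB _).
rewrite -bigcap_seq (big_tnth _ _ s)/= => <-; last first.
  by move=> i j /finj; rewrite !es => /(_ isT isT) /tuple_uniqP; exact.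
congr (P _); apply/seteqP; split => om H.
  by move=> j _; apply: H => /=; exact: es.
by move=> a /= /(tnthP (in_tuple s))[j ->]; exact: H.
Qed.

Lemma isotropic_gaussian_box (d : nat) (s : R) (X : Omega -> d.-tuple R)
    (B : 'I_d -> set R) : 0 < s -> isotropic_gaussian P s X ->
  (forall i, measurable (B i)) ->
  P (X @^-1` box B) = (\prod_(i < d) gauss s (B i))%E.
Proof.
move=> s0 [mX nX iX] mB.
have := mutually_independent_seq _ _ _ _ _ _ (index_enum 'I_d) id B iX
  (index_enum_uniq _) (in2W (fun _ _ => id)) (fun _ _ => I) mB.
rewrite (eq_bigr (fun i => gauss s (B i))).
  by move=> <-; rewrite preimage_box.
by move=> i _; rewrite -(normal_prob_gauss _ _ s0 (mB i)); exact: nX.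
Qed.

End product_rules.

(** * The tree with the queries as an additional level *)

Section refined_tree.
Context {R : realType} {d0 : measure_display} {Omega : measurableType d0}.
Variables (t0 t1 : R) (L : nat) (q : nat -> R).

(* Level [L.+1] refines the dyadic grid by one point [q k] in each leaf. *)
Definition refined_time (l k : nat) : R :=
  if (l <= L)%N then dyadic t0 t1 l k
  else if odd k then q k./2 else dyadic t0 t1 L k./2.

Definition refined_path (g : vbt_node -> R) (l k : nat) : R :=
  if (l <= L)%N then vbt_grid t0 t1 g l k
  else if odd k then
    let s := dyadic t0 t1 L k./2 in let u := dyadic t0 t1 L k./2.+1 in
    let ws := vbt_grid t0 t1 g L k./2 in let wu := vbt_grid t0 t1 g L k./2.+1 in
    ws + (q k./2 - s) / (u - s) * (wu - ws)
    + Num.sqrt ((q k./2 - s) * (u - q k./2) / (u - s)) * g (Leaf k./2)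
  else vbt_grid t0 t1 g L k./2.

(** The node whose Gaussian vector splits interval [k] of level [l]: a midpoint step for [l < L],
    the final interpolation for [l = L]. *)
Definition level_node (l k : nat) : vbt_node := if (l < L)%N then Inner l k else Leaf k.

Lemma level_node_inj l k l' k' : (l <= L)%N -> (l' <= L)%N ->
  level_node l k = level_node l' k' -> (l, k) = (l', k').
Proof.
rewrite /level_node => lL lL'; case: ltnP => h; case: ltnP => h' // [].
  by move=> -> ->.
by move=> ->; congr pair; apply/eqP; rewrite eqn_leq (leq_trans lL h') (leq_trans lL' h).
Qed.

Lemma vbt_nodes_level l k : (l <= L)%N -> (k < 2 ^ l)%N -> vbt_nodes L (level_node l k).
Proof.
rewrite /level_node => lL kl; case: ltnP => h //=.
by have <- : l = L by apply/eqP; rewrite eqn_leq lL h.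
Qed.

Lemma dyadicS l k : dyadic t0 t1 l k.+1 - dyadic t0 t1 l k = (t1 - t0) * 2 ^- l.
Proof. by rewrite /dyadic -natr1; ring. Qed.

Lemma dyadic_lt l k : t0 < t1 -> dyadic t0 t1 l k < dyadic t0 t1 l k.+1.
Proof.
by move=> t01; rewrite -subr_gt0 dyadicS mulr_gt0 ?subr_gt0// invr_gt0 exprn_gt0.
Qed.

Lemma dyadic_double l k : dyadic t0 t1 l.+1 k.*2 = dyadic t0 t1 l k.
Proof.
have n2 : (2 : R) ^+ l != 0 by rewrite expf_neq0.
by rewrite /dyadic -muln2 natrM exprS; field.
Qed.

Lemma refined_time_double l k : (l <= L)%N ->
  refined_time l.+1 k.*2 = refined_time l k.
Proof.
move=> lL; rewrite /refined_time lL odd_double doubleK; case: ltnP => Ll.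
  by rewrite dyadic_double.
by have <- : l = L by apply/eqP; rewrite eqn_leq lL.
Qed.

Lemma refined_path_double g l k : (l <= L)%N ->
  refined_path g l.+1 k.*2 = refined_path g l k.
Proof.
move=> lL; rewrite /refined_path lL/= odd_double doubleK; case: ltnP => Ll//.
by have <- : l = L by apply/eqP; rewrite eqn_leq lL.
Qed.

Lemma dyadic_mid l k :
  dyadic t0 t1 l.+1 k.*2.+1 = (dyadic t0 t1 l k + dyadic t0 t1 l k.+1) / 2.
Proof.
have n2 : (2 : R) ^+ l != 0 by rewrite expf_neq0.
rewrite -(dyadic_double l k) -(dyadic_double l k.+1) doubleS.
rewrite /dyadic -[k.*2.+2%:R]natr1 -[k.*2.+1%:R]natr1 exprS.
by set K := k.*2%:R; field.
Qed.

Hypothesis t01 : t0 < t1.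
Hypothesis q_itv : forall k, (k < 2 ^ L)%N ->
  dyadic t0 t1 L k <= q k <= dyadic t0 t1 L k.+1.

Lemma refined_time_lt l k : (l <= L)%N -> refined_time l k < refined_time l k.+1.
Proof. by move=> lL; rewrite /refined_time lL dyadic_lt. Qed.

Lemma refined_time_mid l k : (l <= L)%N -> (k < 2 ^ l)%N ->
  refined_time l k <= refined_time l.+1 k.*2.+1 <= refined_time l k.+1.
Proof.
move=> lL kl; rewrite /refined_time lL/= odd_double/= uphalf_double.
case: ltnP => Ll.
  by have := dyadic_lt l k t01; rewrite dyadic_mid => lt; apply/andP; split; lra.
have lE : l = L by apply/eqP; rewrite eqn_leq lL.
by rewrite lE; apply: q_itv; rewrite -lE.
Qed.

(** At the midpoint the bridge variance is a quarter of [u - s], so the midpoint rule is the general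
    bridge formula; on the last level the formula is the final interpolation itself. *)
Lemma refined_path_mid g l k : (l <= L)%N ->
  let s := refined_time l k in let u := refined_time l k.+1 in
  let t := refined_time l.+1 k.*2.+1 in
  refined_path g l.+1 k.*2.+1 = refined_path g l k +
    (t - s) / (u - s) * (refined_path g l k.+1 - refined_path g l k)
    + Num.sqrt ((t - s) * (u - t) / (u - s)) * g (level_node l k).
Proof.
move=> lL s u t; rewrite {}/s {}/u {}/t /refined_path /refined_time lL/=.
rewrite odd_double/= uphalf_double /level_node; case: ltnP => Ll; last first.
  by have <- : l = L by apply/eqP; rewrite eqn_leq lL.
rewrite dyadic_mid; set s := dyadic _ _ l k; set u := dyadic _ _ l k.+1.
have us : 0 < u - s by rewrite subr_gt0 dyadic_lt.
have us0 : u - s != 0 by rewrite gt_eqF.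
have -> : ((s + u) / 2 - s) * (u - (s + u) / 2) / (u - s) = 2^-1 ^+ 2 * (u - s).
  by field.
rewrite sqrtrM ?sqr_ge0// sqrtr_sqr ger0_norm//.
by congr (_ + _); field.
Qed.

Lemma measurable_vbt_grid (d : nat) (Z : vbt_node -> Omega -> d.-tuple R) i l k :
  (forall n, vbt_nodes L n -> measurable_fun setT (Z n)) ->
  (l <= L)%N -> (k <= 2 ^ l)%N ->
  measurable_fun setT (fun om => vbt_grid t0 t1 (fun n => tnth (Z n om) i) l k).
Proof.
move=> mZ; have mZi n : vbt_nodes L n -> measurable_fun setT (fun om => tnth (Z n om) i).
  by move=> nL; apply: (measurableT_comp (measurable_tnth i)); exact: mZ.
elim: l k => [|l IH] k lL kl /=.
  by case: (k == 0)%N => //; apply: measurable_funM => //; exact: mZi.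
have lL' := ltnW lL.
have k2 : (k./2 <= 2 ^ l)%N.
  by rewrite -leq_double -[(2 ^ l).*2]mul2n -expnS (leq_trans _ kl)//
    -[leqRHS]odd_double_half leq_addl.
case odk: (odd k); last exact: IH.
have k2' : (k./2 < 2 ^ l)%N.
  by rewrite -ltn_double -[(2 ^ l).*2]mul2n -expnS (leq_trans _ kl)//
    -[leqRHS]odd_double_half odk.
apply: measurable_funD.
  by apply: measurable_funM => //; apply: measurable_funD; exact: IH.
by apply: measurable_funM => //; apply: mZi; split.
Qed.

(** An instance of the bridge tree with [L.+1] splitting levels. What remains is the invariant at
    level 0, where the only increment is the scaled root vector. *)
Lemma vbt_increments (P : probability Omega R) (d : nat)
    (Z : vbt_node -> Omega -> d.-tuple R) (A : nat -> 'I_d -> set R) :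
  vbt_noise P L Z -> (forall k i, measurable (A k i)) ->
  P (level_event d (fun k i om =>
      refined_path (fun n => tnth (Z n om) i) L.+1 k.+1 -
      refined_path (fun n => tnth (Z n om) i) L.+1 k) (2 ^ L.+1) A) =
  (\prod_(k < 2 ^ L.+1) \prod_(i < d)
    gauss (Num.sqrt (refined_time L.+1 k.+1 - refined_time L.+1 k)) (A k i))%E.
Proof.
move=> [gZ iZ] mA.
have mZ n : vbt_nodes L n -> measurable_fun setT (Z n) by move=> /gZ[].
pose x l k (i : 'I_d) om := refined_path (fun n => tnth (Z n om) i) l k.
pose g l k (i : 'I_d) om := tnth (Z (level_node l k) om) i.
apply: (independent_at_last P L.+1 d refined_time x g) => //.
- move=> l k i lL kl; rewrite /x /refined_path -ltnS lL.
  exact: measurable_vbt_grid.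
- move=> l k i lL kl; apply: (measurableT_comp (measurable_tnth i)).
  by apply: mZ; exact: vbt_nodes_level.
- by move=> l k lL _; exact: refined_time_lt.
- by move=> l k lL; exact: refined_time_double.
- by move=> l k lL kl; exact: refined_time_mid.
- by move=> l k lL; apply/funext => i; apply/funext => om; exact: refined_path_double.
- by move=> l k i om lL _; exact: refined_path_mid.
move=> {mA}A B mA mB.
have [ms msE] : exists ms, ms = index_iota 0 L.+1 by exists (index_iota 0 L.+1).
(* [None] labels the root and [Some (m, k)] the node splitting interval [k] of level [m], so
   [None :: lab] runs through the nodes of the tree without repetition. *)
pose lab := [seq Some (m, k) | m <- ms, k <- index_iota 0 (2 ^ m)].
pose f a := if a is Some (m, k) then level_node m k else Root.
pose h := Num.sqrt (t1 - t0).
(* For the root, the sets of the single level 0 increment are pulled back along multiplication by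
   [h]. *)
pose S a : set (d.-tuple R) := if a is Some (m, k) then box (B m k)
  else box (fun i => (fun y => h * y) @^-1` A 0%N i).
have labP a : a \in lab -> exists m k, [/\ (m <= L)%N, (k < 2 ^ m)%N & a = Some (m, k)].
  by case/allpairsPdep => m [k] []; rewrite msE !mem_index_iota /= => ? ? ->; exists m, k.
have ulab : uniq (None :: lab).
  rewrite cons_uniq; apply/andP; split; first by apply/negP => /labP[m [k []]].
  apply: allpairs_uniq_dep; [by rewrite msE; exact: iota_uniq|by move=> *; exact: iota_uniq|].
  by move=> [m k] [m' k'] _ _ /= [-> ->].
have finj : {in None :: lab &, injective f}.
  move=> a b; rewrite !inE => /orP[/eqP->|/labP[m [k [mL _ ->]]]];
    move=> /orP[/eqP->|/labP[m' [k' [mL' _ ->]]]] //=.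
  - by rewrite /level_node; case: ifP.
  - by rewrite /level_node; case: ifP.
  - by move=> /level_node_inj => /(_ mL mL') ->.
have labD a : a \in None :: lab -> vbt_nodes L (f a).
  rewrite inE => /orP[/eqP->//|/labP[m [k [mL kL ->]]]].
  exact: vbt_nodes_level.
have mS a : measurable (S a).
  case: a => [[m k]|]; apply: measurable_box => // i.
  by apply: measurable_preimage => //; exact: measurable_scale.
have := mutually_independent_seq P _ _ _ _ _ _ _ _ _ iZ ulab finj labD mS.
rewrite !big_cons /lab !big_allpairs_dep /=.
have PB m k : (m <= L)%N -> (k < 2 ^ m)%N ->
    P (Z (level_node m k) @^-1` box (B m k)) = (\prod_(i < d) normal1 (B m k i))%E.
  move=> mL kL; rewrite -gauss1; apply: isotropic_gaussian_box => //.
  by apply: gZ; exact: vbt_nodes_level.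
have PR : P (Z Root @^-1` box (fun i => (fun y => h * y) @^-1` A 0%N i)) =
    (\prod_(i < d) gauss h (A 0%N i))%E.
  rewrite (isotropic_gaussian_box P _ 1)//; first by rewrite gauss1.
  - exact: gZ.
  - by move=> i; apply: measurable_preimage => //; exact: measurable_scale.
rewrite PR.
have -> : (\big[setI/setT]_(m <- ms) \big[setI/setT]_(k <- index_iota 0 (2 ^ m))
    Z (level_node m k) @^-1` box (B m k)) = noise_event L.+1 d g 0 B.
  rewrite msE; apply: eq_bigr => m _; rewrite /level_event big_mkord; apply: eq_bigr => k _.
  exact: preimage_box.
have -> : (\prod_(m <- ms) \prod_(k <- index_iota 0 (2 ^ m))
    P (Z (level_node m k) @^-1` box (B m k)))%E = noise_prob L.+1 d 0 B.
  rewrite msE; apply: eq_big_nat => m /andP[_ mL]; rewrite big_mkord; apply: eq_bigr => k _.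
  by rewrite PB.
have timeE : refined_time 0 1 - refined_time 0 0 = t1 - t0.
  by rewrite /refined_time/= dyadicS expr0 invr1 mulr1.
have -> : Z Root @^-1` box (fun i => (fun y => h * y) @^-1` A 0%N i) =
    level_event d (fun k i om => x 0%N k.+1 i om - x 0%N k i om) (2 ^ 0) A.
  rewrite preimage_box /level_event expn0 big_ord1; apply: eq_bigr => i _.
  by apply/seteqP; split => om; rewrite /x /refined_path/= subr0.
move=> ->; rewrite expn0 big_ord1; congr (_ * _)%E; apply: eq_bigr => i _.
by rewrite /h -timeE.
Qed.

End refined_tree.

Section brownian_increments.
Context {R : realType} {d0 : measure_display} {Omega : measurableType d0}.

Lemma brownian_increments (P : probability Omega R) (t0 t1 : R) (d n : nat)
    (W : R -> Omega -> d.-tuple R) (t : nat -> R) (A : nat -> 'I_d -> set R) :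
  brownian_motion P t0 t1 W ->
  (forall i, (i <= n)%N -> t0 <= t i <= t1) ->
  (forall i, (i < n)%N -> t i <= t i.+1) ->
  (forall k i, measurable (A k i)) ->
  P (level_event d (fun k i om => tnth (W (t k.+1) om) i - tnth (W (t k) om) i) n A) =
  (\prod_(k < n) \prod_(i < d) gauss (Num.sqrt (t k.+1 - t k)) (A k i))%E.
Proof.
move=> bm tI tS mA.
have incE k i om : tnth (increment W (t k) (t k.+1) om) i =
    tnth (W (t k.+1) om) i - tnth (W (t k) om) i by rewrite tnth_mktuple.
have indW := bm_independent bm tI tS.
have := mutually_independent_seq P _ _ _ _ _ _ (index_enum 'I_n) id
  (fun k : 'I_n => box (A k)) indW
  (index_enum_uniq _) (in2W (fun _ _ => id)) (fun _ _ => I)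
  (fun k => measurable_box _ (mA k)).
rewrite (_ : \big[setI/setT]_(a <- _) _ = level_event d (fun k i om =>
    tnth (W (t k.+1) om) i - tnth (W (t k) om) i) n A); last first.
  apply: eq_bigr => k _; rewrite preimage_box; apply: eq_bigr => i _.
  by apply/seteqP; split => om; rewrite /= incE.
move=> ->; apply: eq_bigr => k _.
have /andP[tk0 _] := tI k (ltnW (ltn_ord k)).
have /andP[_ tk1] := tI k.+1 (ltn_ord k).
(* Consecutive times may coincide. The increment then vanishes identically, and both sides are 1 or
   0 according to whether all the sets contain 0. *)
have := tS k (ltn_ord k); rewrite le_eqVlt => /orP[/eqP tk|tk].
  have -> : t k.+1 - t k = 0 by rewrite -tk subrr.
  rewrite sqrtr0; under [RHS]eq_bigr do rewrite gauss0.
  rewrite preimage_box (_ : \big[setI/setT]_(i < d) _ =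
    if [forall i, 0 \in A k i] then setT else set0).
    case: ifPn => [/forallP A0|]; first
      by rewrite probability_setT big1// => i _; rewrite indicE A0.
    rewrite negb_forall => /existsP[i Ai0]; rewrite measure0 (bigD1 i)//= indicE.
    by rewrite (negbTE Ai0) mul0e.
  rewrite -bigcap_seq; apply/seteqP; split => om /=.
    move=> H; have -> // : [forall i, 0 \in A k i].
    apply/forallP => i; apply/mem_set; have := H i; rewrite /= incE -tk subrr; apply.
    by rewrite mem_index_enum.
  case: ifPn => // /forallP A0 _ i _; rewrite /= incE -tk subrr; exact/set_mem.
apply: isotropic_gaussian_box => //; first by rewrite sqrtr_gt0 subr_gt0.
exact: (bm_gaussian bm).
Qed.

End brownian_increments.

(** * Joint laws determined by boxes *)

Section law_of_array.
Context {R : realType} {M d : nat}.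

Definition array {T : Type} (F : nat -> 'I_d -> T -> R) (om : T) : M.-tuple (d.-tuple R) :=
  [tuple [tuple F k i om | i < d] | k < M].

Definition array_box (A : nat -> 'I_d -> set R) : set (M.-tuple (d.-tuple R)) :=
  [set v | forall (k : 'I_M) i, A k i (tnth (tnth v k) i)].

Lemma preimage_array_box {d0} {T : measurableType d0} (F : nat -> 'I_d -> T -> R) A :
  array F @^-1` array_box A = level_event d F M A.
Proof.
rewrite /level_event; under eq_bigr do rewrite -bigcap_seq.
rewrite -bigcap_seq; apply/seteqP; split => om /= H.
  by move=> k _ i _; have := H k i; rewrite !tnth_mktuple.
move=> k i; rewrite !tnth_mktuple.
by apply: (H k _ i); rewrite /= mem_index_enum.
Qed.

Lemma measurable_array {d0} {T : measurableType d0} (F : nat -> 'I_d -> T -> R) :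
  (forall k i, (k < M)%N -> measurable_fun setT (F k i)) ->
  measurable_fun setT (array F).
Proof.
move=> mF; apply/measurable_fun_tnthP => k; apply/measurable_fun_tnthP => i.
rewrite (_ : _ \o _ = F k i); first exact: mF.
by apply/funext => om; rewrite /= !tnth_mktuple.
Qed.

Lemma measurable_array_box A : (forall k i, measurable (A k i)) ->
  measurable (array_box A).
Proof.
move=> mA; rewrite (_ : array_box A = \big[setI/setT]_(k < M)
    \big[setI/setT]_(i < d) (fun v => tnth (tnth v k) i) @^-1` A k i).
  apply: measurable_bigsetI => k; apply: measurable_bigsetI => i.
  apply: measurable_preimage => //.
  exact: (measurableT_comp (measurable_tnth i) (measurable_tnth k)).
under eq_bigr do rewrite -bigcap_seq.
rewrite -bigcap_seq; apply/seteqP; split => v /= H.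
  by move=> k _ i _; exact: H.
by move=> k i; apply: (H k _ i); rewrite /= mem_index_enum.
Qed.

Let G := [set array_box A | A in [set A | forall k i, measurable (A k i)]].

(** For the inclusion of the product sigma-algebra in the generated one, each coordinate is
    measurable for the latter: the preimage of [B] is the box with [B] in one place and full sets
    elsewhere. *)
Let measurableG : @measurable _ (M.-tuple (d.-tuple R)) = <<s G >>.
Proof.
apply/seteqP; split; last first.
  apply: smallest_sub; first exact: sigma_algebra_measurable.
  by move=> _ [A mA <-]; exact: measurable_array_box.
pose V := g_sigma_algebraType G.
have mid : measurable_fun [set: V] (id : V -> M.-tuple (d.-tuple R)).
  apply/measurable_fun_tnthP => k; apply/measurable_fun_tnthP => i _ B mB.
  rewrite setTI; apply: sub_sigma_algebra.
  exists (fun k' i' => if (k' == k :> nat) && (i' == i) then B else setT).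
    by move=> k' i' /=; case: ifP.
  apply/seteqP; split => v /= H; first by have := H k i; rewrite !eqxx.
  by move=> k' i'; case: ifP => // /andP[/eqP/val_inj -> /eqP ->].
by move=> S mS; have := mid measurableT S mS; rewrite setTI.
Qed.

Lemma array_law {d1 d2} {T1 : measurableType d1} {T2 : measurableType d2}
    (P1 : probability T1 R) (P2 : probability T2 R)
    (F1 : nat -> 'I_d -> T1 -> R) (F2 : nat -> 'I_d -> T2 -> R) S :
  (forall k i, (k < M)%N -> measurable_fun setT (F1 k i)) ->
  (forall k i, (k < M)%N -> measurable_fun setT (F2 k i)) ->
  (forall A, (forall k i, measurable (A k i)) ->
    P1 (level_event d F1 M A) = P2 (level_event d F2 M A)) ->
  measurable S -> P1 (array F1 @^-1` S) = P2 (array F2 @^-1` S).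
Proof.
move=> mF1 mF2 F12 mS.
have [m1 m1E] := pushforward_measure P1 _ (measurable_array _ mF1).
have [m2 m2E] := pushforward_measure P2 _ (measurable_array _ mF2).
rewrite -m1E -m2E; apply: (measure_unique G (fun=> setT)) => //.
- move=> _ _ [A mA <-] [B mB <-]; exists (fun k i => A k i `&` B k i).
    by move=> k i; exact: measurableI.
  apply/seteqP; split => v H; first by split => k i; case: (H k i).
  by case: H => HA HB k i; split; [exact: HA|exact: HB].
- move=> _; exists (fun _ _ => setT) => //.
  by apply/seteqP; split.
- by rewrite bigcup_const.
- by move=> _ [A mA <-]; rewrite m1E m2E !preimage_array_box; exact: F12.
- move=> _; rewrite m1E preimage_setT.
  by apply: (@le_lt_trans _ _ 1%E); [exact: probability_le1|exact: ltry].
Qed.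

End law_of_array.

(** Serves to use that [W] starts at 0 only almost surely. The set where [Q] fails may be
    non-measurable, hence the null set [N] around it. *)
Lemma probability_eq_off_null {R : realType} {d} {T : measurableType d}
    (P : probability T R) (Q : T -> Prop) (A B : set T) :
  {ae P, forall om, Q om} -> measurable A -> measurable B ->
  (forall om, Q om -> A om <-> B om) -> P A = P B.
Proof.
move=> [N [mN PN QN]] mA mB AB.
have le (C D : set T) : measurable C -> measurable D ->
    (forall om, Q om -> C om -> D om) -> (P C <= P D)%E.
  move=> mC mD CD; apply: (@le_trans _ _ (P (D `|` N))).
    apply: le_measure; rewrite ?inE//; first exact: measurableU.
    move=> om Com; have [Nom|Nom] := pselect (N om); first by right.
    by left; apply: CD => //; apply: contrapT => nQ; apply: Nom; exact: QN.
  by apply: le_trans (measureU2 _ mD mN) _; rewrite [X in (_ + X)%E]PN adde0.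
by apply/eqP; rewrite eq_le; apply/andP; split; apply: le => // om Qom /AB; exact.
Qed.

(** * Leaves and points of the finest dyadic grid *)

Section grid.
Context {R : realType}.
Variables (t0 t1 : R) (L : nat).
Hypothesis t01 : t0 < t1.

Lemma dyadic_ltn k j : (dyadic t0 t1 L k < dyadic t0 t1 L j) = (k < j)%N.
Proof.
rewrite /dyadic ltrD2l -!mulrA ltr_pM2l ?subr_gt0// ltr_pM2r ?invr_gt0 ?exprn_gt0//.
by rewrite ltr_nat.
Qed.

Lemma dyadic0 : dyadic t0 t1 L 0 = t0.
Proof. by rewrite /dyadic mulr0 mul0r addr0. Qed.

Lemma dyadic_max : dyadic t0 t1 L (2 ^ L) = t1.
Proof.
have n2 : (2 : R) ^+ L != 0 by rewrite expf_neq0.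
by rewrite /dyadic natrX; field.
Qed.

Lemma vbt_leaf0 : vbt_leaf t0 t1 L t0 = 0%N.
Proof. by rewrite /vbt_leaf subrr !mul0r ceil0. Qed.

(** The rescaled time [c] lies in the half-open interval from 0 to [2 ^ L], and its ceiling [m]
    satisfies [m - 1 < c <= m]; the leaf number is [m - 1]. *)
Lemma vbt_leafP r : t0 < r <= t1 -> let k := vbt_leaf t0 t1 L r in
  (k < 2 ^ L)%N /\ dyadic t0 t1 L k < r <= dyadic t0 t1 L k.+1.
Proof.
move=> /andP[r0 r1]; rewrite /vbt_leaf.
have n2 : 0 < (2 : R) ^+ L by rewrite exprn_gt0.
have t10 : 0 < t1 - t0 by rewrite subr_gt0.
set c := (r - t0) / (t1 - t0) * 2 ^+ L.
have c0 : 0 < c by rewrite mulr_gt0// divr_gt0// subr_gt0.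
have cE : r = t0 + (t1 - t0) * c * 2 ^- L by rewrite /c; field; rewrite !gt_eqF.
have cL : c <= (2 ^ L)%:R.
  rewrite natrX /c -[leRHS]mul1r ler_pM2r// ler_pdivrMr// mul1r lerD2r//.
have m0 : 0 < Num.ceil c by rewrite ceil_gt0.
have mE : (`|Num.ceil c|%N : int) = Num.ceil c by rewrite gez0_abs// ltW.
set m := `|Num.ceil c|%N in mE *.
have mgt0 : (0 < m)%N by rewrite -ltz_nat mE.
have cm : c <= m%:R by rewrite pmulrn mE ceil_ge.
have mc : m.-1%:R < c.
  have := ceilB1_lt c; rewrite -mE rmorphB/= -pmulrn.
  by rewrite -{1}(prednK mgt0) -natr1 addrK.
split; first by rewrite -(ltr_nat R) (lt_le_trans mc).
rewrite prednK//; apply/andP; split.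
  by rewrite [ltRHS]cE /dyadic ltrD2l ltr_pM2r ?invr_gt0// ltr_pM2l.
by rewrite [leLHS]cE /dyadic lerD2l ler_pM2r ?invr_gt0// ler_pM2l.
Qed.

(** A grid point is the right end of its leaf, or the left end of the first leaf if [k = 0]; at
    either end the bridge noise has coefficient 0. *)
Lemma vbt_coord_grid g k : (k <= 2 ^ L)%N ->
  vbt_coord t0 t1 L g (dyadic t0 t1 L k) = vbt_grid t0 t1 g L k.
Proof.
case: k => [_|k kL]; rewrite /vbt_coord.
  rewrite dyadic0 vbt_leaf0 dyadic0 subrr !mul0r sqrtr0 mul0r !addr0.
  (* The value 0 at index 0 is passed on unchanged from level to level. *)
  by elim: L.
have -> : vbt_leaf t0 t1 L (dyadic t0 t1 L k.+1) = k.
  have rI : t0 < dyadic t0 t1 L k.+1 <= t1.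
    apply/andP; split; first by rewrite -[ltLHS]dyadic0 dyadic_ltn.
    by rewrite -[leRHS]dyadic_max leNgt dyadic_ltn -leqNgt.
  have [_] := vbt_leafP _ rI.
  rewrite dyadic_ltn ltnS leNgt dyadic_ltn -leqNgt ltnS => /andP[h1 h2].
  by apply/eqP; rewrite eqn_leq h1 h2.
rewrite subrr mulr0 mul0r sqrtr0 mul0r addr0 divff ?mul1r; first by rewrite addrC subrK.
by rewrite gt_eqF// subr_gt0 dyadic_ltn.
Qed.

End grid.

(** * Query times *)

Section queries.
Context {R : realType}.
Variables (t0 t1 : R) (L N : nat) (r : N.-tuple R).
Hypothesis t01 : t0 < t1.
Hypothesis r_itv : forall n : 'I_N, t0 <= tnth r n <= t1.
Hypothesis r_sep : forall n : nat, (n.+1 < N)%N ->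
  r`_n <= r`_n.+1 /\ dyadic_grid t0 t1 L `&` `[r`_n, r`_n.+1] !=set0.

Let inside (n : 'I_N) k := dyadic t0 t1 L k < tnth r n < dyadic t0 t1 L k.+1.

Lemma query_le m n : (m <= n)%N -> (n < N)%N -> r`_m <= r`_n.
Proof.
move=> mn; rewrite -(subnK mn); elim: (n - m)%N => [|p IH] pN //.
by rewrite addSn in pN *; apply: le_trans (IH (ltnW pN)) _; case: (r_sep _ pN).
Qed.

(** The grid point separating query [m] from its successor would lie strictly between two
    consecutive grid points. *)
Lemma query_leaf_lt (m n : 'I_N) k : (m < n)%N -> inside m k -> inside n k -> False.
Proof.
rewrite /inside !(tnth_nth 0) => mn /andP[km _] /andP[_ nk].
have mN : (m.+1 < N)%N by exact: leq_ltn_trans mn (ltn_ord n).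
have [_ [y [[j /= jL jy]]]] := r_sep _ mN.
rewrite /= in_itv/= => /andP[my ym].
have : dyadic t0 t1 L k < dyadic t0 t1 L j by rewrite jy (lt_le_trans km).
have : dyadic t0 t1 L j < dyadic t0 t1 L k.+1.
  by rewrite jy (le_lt_trans ym)// (le_lt_trans _ nk)// query_le.
by rewrite !dyadic_ltn// ltnS leqNgt => /negP.
Qed.

Lemma query_leaf_inj (m n : 'I_N) k : inside m k -> inside n k -> m = n.
Proof.
move=> mk nk; apply/val_inj; case: (ltngtP (val m) (val n)) => // h.
  by case: (query_leaf_lt m n k).
by case: (query_leaf_lt n m k).
Qed.

(* Each leaf contains at most one query off the grid; it is used as refining point. *)
Lemma query_refinement : exists q : nat -> R,
  (forall k, (k < 2 ^ L)%N -> dyadic t0 t1 L k <= q k <= dyadic t0 t1 L k.+1) /\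
  forall n : 'I_N, exists j, [/\ (j <= 2 ^ L.+1)%N,
    refined_time t0 t1 L q L.+1 j = tnth r n &
    forall g, vbt_coord t0 t1 L g (tnth r n) = refined_path t0 t1 L q g L.+1 j].
Proof.
(* In a leaf without interior query the left end serves as a default, giving a step of length
   zero. *)
pose q k := if [pick n | inside n k] is Some n then tnth r n else dyadic t0 t1 L k.
have le k : dyadic t0 t1 L k <= dyadic t0 t1 L k.+1 by rewrite ltW// dyadic_ltn.
exists q; split => [k kL|n].
  by rewrite /q; case: pickP => [n /andP[h1 h2]|_]; rewrite ?lexx ?le// !ltW.
(* A query at grid point [k] has the even index [k.*2] in the refined level; an interior query of
   leaf [k] will have the odd index [k.*2.+1]. *)
have gridP k : (k <= 2 ^ L)%N -> tnth r n = dyadic t0 t1 L k ->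
    exists j, [/\ (j <= 2 ^ L.+1)%N, refined_time t0 t1 L q L.+1 j = tnth r n &
    forall g, vbt_coord t0 t1 L g (tnth r n) = refined_path t0 t1 L q g L.+1 j].
  move=> kL rk; exists k.*2; split.
  - by rewrite expnS mul2n leq_double.
  - by rewrite /refined_time ltnn odd_double doubleK.
  - by move=> g; rewrite rk vbt_coord_grid// /refined_path ltnn odd_double doubleK.
have /andP[rt0 rt1] := r_itv n.
move: rt0; rewrite le_eqVlt => /orP[/eqP r0|r0].
  by apply: (gridP 0%N) => //; rewrite dyadic0 -r0.
have rI : t0 < tnth r n <= t1 by rewrite r0.
have := vbt_leafP t0 t1 L t01 _ rI; set k := vbt_leaf t0 t1 L (tnth r n).
move=> [kL /andP[kr]]; rewrite le_eqVlt => /orP[/eqP rk|rk].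
  exact: (gridP k.+1).
have nk : inside n k by rewrite /inside kr.
have qk : q k = tnth r n.
  rewrite /q; case: pickP => [m mk|/(_ n)]; last by rewrite nk.
  by rewrite (query_leaf_inj m n k).
exists k.*2.+1; split.
- by rewrite expnS mul2n ltn_double.
- by rewrite /refined_time ltnn/= odd_double/= uphalf_double.
- by move=> g; rewrite /refined_path ltnn/= odd_double/= uphalf_double qk.
Qed.

End queries.

Lemma measurable_refined_path {R : realType} {d0} {Omega : measurableType d0}
    (t0 t1 : R) (L d : nat) (q : nat -> R) (Z : vbt_node -> Omega -> d.-tuple R)
    (i : 'I_d) k :
  (forall n, vbt_nodes L n -> measurable_fun setT (Z n)) -> (k <= 2 ^ L.+1)%N ->
  measurable_fun setT
    (fun om => refined_path t0 t1 L q (fun n => tnth (Z n om) i) L.+1 k).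
Proof.
move=> mZ kL; rewrite /refined_path ltnn.
have mg j : (j <= 2 ^ L)%N ->
    measurable_fun setT (fun om => vbt_grid t0 t1 (fun n => tnth (Z n om) i) L j).
  by move=> jL; apply: (measurable_vbt_grid _ _ _ d Z i L j mZ).
case odk: (odd k); last first.
  apply: mg; rewrite -leq_double -[(2 ^ L).*2]mul2n -expnS (leq_trans _ kL)//.
  by rewrite -[leqRHS]odd_double_half leq_addl.
have k2 : (k./2 < 2 ^ L)%N.
  rewrite -ltn_double -[(2 ^ L).*2]mul2n -expnS (leq_trans _ kL)//.
  by rewrite -[leqRHS]odd_double_half odk.
apply: measurable_funD.
  apply: measurable_funD; first by apply: mg; exact: ltnW.
  apply: measurable_funM => //; apply: measurable_funB; apply: mg => //; exact: ltnW.
apply: measurable_funM => //; apply: (measurableT_comp (measurable_tnth i)).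
exact: mZ.
Qed.

(** * Recovering the paths from their increments *)

Section partial_sums.
Context {R : realType} (M d N : nat) (J : 'I_N -> nat).

(** The sum runs over all [M] indices with a cutoff at [J n], so that its index addresses the tuple
    [v] directly. *)
Definition partial_sums (v : M.-tuple (d.-tuple R)) : N.-tuple (d.-tuple R) :=
  [tuple [tuple \sum_(k < M) (if (k < J n)%N then tnth (tnth v k) i else 0)
    | i < d] | n < N].

Lemma measurable_partial_sums : measurable_fun setT partial_sums.
Proof.
apply/measurable_fun_tnthP => n; apply/measurable_fun_tnthP => i.
rewrite (_ : _ \o _ = fun v =>
  \sum_(k < M) (if (k < J n)%N then tnth (tnth v k) i else 0)); last first.
  by apply/funext => v; rewrite /= !tnth_mktuple.
apply: measurable_sum => k; case: (k < J n)%N => //.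
exact: (measurableT_comp (measurable_tnth i) (measurable_tnth k)).
Qed.

Lemma partial_sums_array {T : Type} (X : nat -> 'I_d -> T -> R) n i om :
  (forall n, (J n <= M)%N) ->
  tnth (tnth (partial_sums (array (fun k i om => X k.+1 i om - X k i om) om)) n) i =
  X (J n) i om - X 0%N i om.
Proof.
move=> JM; rewrite !tnth_mktuple.
transitivity (\sum_(k < M | (k < J n)%N) (X k.+1 i om - X k i om)).
  rewrite [RHS]big_mkcond; apply: eq_bigr => k _.
  by rewrite !tnth_mktuple.
rewrite -(big_ord_widen _ (fun k => X k.+1 i om - X k i om) (JM n)).
rewrite -(big_mkord xpredT (fun k => X k.+1 i om - X k i om)).
by rewrite (telescope_sumr (fun k => X k i om)).
Qed.

End partial_sums.

Theorem theorem3p1 (R : realType) (t0 t1 : R) (L d N : nat)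
    (d1 : measure_display) (Omega1 : measurableType d1)
    (P1 : probability Omega1 R) (Z : vbt_node -> Omega1 -> d.-tuple R)
    (d2 : measure_display) (Omega2 : measurableType d2)
    (P2 : probability Omega2 R) (W : R -> Omega2 -> d.-tuple R)
    (r : N.-tuple R) :
  t0 < t1 ->
  vbt_noise P1 L Z ->
  brownian_motion P2 t0 t1 W ->
  (forall n : 'I_N, t0 <= tnth r n <= t1) ->
  (forall n : nat, (n.+1 < N)%N ->
     r`_n <= r`_n.+1 /\
     dyadic_grid t0 t1 L `&` `[r`_n, r`_n.+1] !=set0) ->
  eq_in_law P1 (fun om => [tuple vbt_path t0 t1 L Z (tnth r n) om | n < N])
            P2 (fun om => [tuple W (tnth r n) om | n < N]).
Proof.
move=> t01 noise bm rI rS.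
(* [J n] is the position of query [n] among the refined times. *)
have [q [q_itv /choice[J JP]]] := query_refinement t0 t1 L N r t01 rI rS.
pose tau := refined_time t0 t1 L q L.+1.
pose M := (2 ^ L.+1)%N.
have JM n : (J n <= M)%N by case: (JP n).
have Jtau n : tau (J n) = tnth r n by case: (JP n).
have tauS k : (k < M)%N -> tau k <= tau k.+1.
  move=> kM; rewrite /tau -(odd_double_half k).
  have k2 : (k./2 < 2 ^ L)%N.
    rewrite -ltn_double -[(2 ^ L).*2]mul2n -expnS (leq_ltn_trans _ kM)//.
    by rewrite -[leqRHS]odd_double_half leq_addl.
  have /andP[h1 h2] := refined_time_mid t0 t1 L q t01 q_itv _ _ (leqnn L) k2.
  case: (odd k); rewrite /= ?add1n ?add0n ?refined_time_double//.
  by rewrite -doubleS refined_time_double.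
have tau_le m n : (m <= n)%N -> (n <= M)%N -> tau m <= tau n.
  move=> mn; rewrite -(subnK mn); elim: (n - m)%N => [|p IH] pM //.
  by rewrite addSn in pM *; apply: le_trans (IH (ltnW pM)) _; exact: tauS.
have tau0 : tau 0%N = t0 by rewrite /tau /refined_time ltnn/= dyadic0.
have tauM : tau M = t1.
  rewrite /tau /M expnS mul2n /refined_time ltnn odd_double doubleK.
  exact: dyadic_max.
have tauI k : (k <= M)%N -> t0 <= tau k <= t1.
  by move=> kM; rewrite -tau0 -tauM !tau_le.
have mZ n : vbt_nodes L n -> measurable_fun setT (Z n) by move=> /noise.1[].
pose X1 k (i : 'I_d) om := refined_path t0 t1 L q (fun n => tnth (Z n om) i) L.+1 k.
pose X2 k (i : 'I_d) om := tnth (W (tau k) om) i.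
pose F1 k i om := X1 k.+1 i om - X1 k i om.
pose F2 k i om := X2 k.+1 i om - X2 k i om.
have mX1 k i : (k <= M)%N -> measurable_fun setT (X1 k i).
  exact: measurable_refined_path.
have mX2 k i : (k <= M)%N -> measurable_fun setT (X2 k i).
  move=> kM; apply: (measurableT_comp (measurable_tnth i)).
  by apply: (bm_measurable bm); exact: tauI.
have mF1 k i : (k < M)%N -> measurable_fun setT (F1 k i).
  by move=> kM; apply: measurable_funB; apply: mX1 => //; exact: ltnW.
have mF2 k i : (k < M)%N -> measurable_fun setT (F2 k i).
  by move=> kM; apply: measurable_funB; apply: mX2 => //; exact: ltnW.
have F12 A : (forall k i, measurable (A k i)) ->
    P1 (level_event d F1 M A) = P2 (level_event d F2 M A).
  move=> mA; rewrite (vbt_increments t0 t1 L q t01 q_itv P1 d Z A noise mA).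
  by rewrite -(brownian_increments P2 t0 t1 d M W tau A bm tauI tauS mA).
(* The same measurable map turns either array of increments into the values at the queries, so
   equality of the array laws suffices. *)
pose Phi := @partial_sums R M d N J.
have mPhi : measurable_fun setT Phi by exact: measurable_partial_sums.
have vbtE om : [tuple vbt_path t0 t1 L Z (tnth r n) om | n < N] = Phi (array F1 om).
  apply: eq_from_tnth => n; apply: eq_from_tnth => i.
  rewrite (partial_sums_array M d N J X1)// !tnth_mktuple.
  have [_ _ ->] := JP n; rewrite /X1 [X in _ - X](_ : _ = 0) ?subr0//.
  by rewrite /refined_path ltnn/=; elim: (L).
(* The tree starts at 0 everywhere, [W] only almost surely, so here the identity is conditional on
   the starting value. *)
have bmE om : W t0 om = [tuple 0 | _ < d] ->
    [tuple W (tnth r n) om | n < N] = Phi (array F2 om).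
  move=> W0; apply: eq_from_tnth => n; apply: eq_from_tnth => i.
  rewrite (partial_sums_array M d N J X2)// !tnth_mktuple.
  by rewrite /X2 tau0 W0 Jtau tnth_mktuple subr0.
have mV1 : measurable_fun setT (Phi \o array F1).
  by apply: measurableT_comp => //; exact: measurable_array.
have mV2 : measurable_fun setT (Phi \o array F2).
  by apply: measurableT_comp => //; exact: measurable_array.
have mW : measurable_fun setT (fun om => [tuple W (tnth r n) om | n < N]).
  apply/measurable_fun_tnthP => n; rewrite (_ : _ \o _ = W (tnth r n)).
    by apply: (bm_measurable bm).
  by apply/funext => om; rewrite /= tnth_mktuple.
have -> : (fun om => [tuple vbt_path t0 t1 L Z (tnth r n) om | n < N]) =
    Phi \o array F1 by apply/funext.
split=> // A mA.
have mA' : measurable (Phi @^-1` A) by exact: measurable_preimage.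
rewrite /pushforward comp_preimage (array_law P1 P2 F1 F2 _ mF1 mF2 F12 mA').
apply: (probability_eq_off_null _ _ _ _ (bm_start bm)).
- exact: measurable_preimage mV2 mA.
- exact: measurable_preimage mW mA.
- by move=> om W0; rewrite /= bmE.
Qed.
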